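(* Consider the single pursuer/multiple evaders game $(P^1)$ with $m>1$ evaders and one pursuer in one-dimensional space, and its modifications $(P^1_i)$, $i=1,\ldots,m$, in which the target $\mathcal{T}=\mathcal{T}_1\cup\cdots\cup\mathcal{T}_m$ is replaced by $\mathcal{T}_i$ (all defined in the context). For $i=1,\ldots,m$ let $u_i$ be the upper value for $(P^1_i)$. Assume: (a) for $i=1,\ldots,m$, $u_i$ is a continuous viscosity solution on $\mathbb{R}^{m+1}\setminus\mathcal{T}_i$ of $$F^1(x_1,\ldots,x_{m+1},D_{x_1}u,\ldots,D_{x_{m+1}}u)=0; \qquad (\ast)$$ (b) for any $i,j\in\{1,\ldots,m\}$, $i\ne j$, and any $(x_1,\ldots,x_{m+1})\in\mathbb{R}^{m+1}\setminus\mathcal{T}$ such that $u_i(x_1,\ldots,x_{m+1})=u_j(x_1,\ldots,x_{m+1})$, the functions $u_i$ and $u_j$ are Lipschitz continuous on a neighbourhood of $(x_1,\ldots,x_{m+1})$. Then $$\bar u(x_1,\ldots,x_{m+1}):=\min\{u_1(x_1,\ldots,x_{m+1}),\ldots,u_m(x_1,\ldots,x_{m+1})\}$$ is a continuous viscosity solution of $(\ast)$ on $\mathbb{R}^{m+1}\setminus\mathcal{T}$.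
   Context: **Dynamics.** The evaders are labelled $1,\ldots,m$ and the pursuer $m+1$; their positions $x_1,\ldots,x_{m+1}\in\mathbb{R}$ evolve according to $$\dot x_i=f_i(x_i,a_i),\ i=1,\ldots,m,\qquad \dot x_{m+1}=f_{m+1}(x_{m+1},b_1),$$ where $f_i:\mathbb{R}\times\mathbb{R}^{r_i}\to\mathbb{R}$ are given functions and the controls satisfy $a_i\in A_i\subset\mathbb{R}^{r_i}$, $b_1\in B_1\subset\mathbb{R}^{r_{m+1}}$, for given (nonempty) sets. It is assumed that the data are such that, for all open loop policies and initial states, the state equation has a unique (absolutely continuous) solution on $[0,\infty)$. **Policies.** $\mathcal{A}$ is the set of $(a_1(\cdot),\ldots,a_m(\cdot))$ with $a_i:[0,\infty)\to\mathbb{R}^{r_i}$ measurable and $a_i(t)\in A_i$ a.e.; $\mathcal{B}$ is the set of measurable $b_1:[0,\infty)\to\mathbb{R}^{r_{m+1}}$ with $b_1(t)\in B_1$ a.e. $\Phi$ is the set of non-anticipative maps $\phi:\mathcal{B}\to\mathcal{A}$, i.e. maps such that for all $t'\ge0$ and $b,b'\in\mathcal{B}$, if $b=b'$ a.e. on $[0,t']$ then $\phi(b)=\phi(b')$ a.e. on $[0,t']$. **Targets and upper values.** For a given constant $r\ge 0$ and $i=1,\ldots,m$, $$\mathcal{T}_i=\{(x_1,\ldots,x_{m+1})\in\mathbb{R}^{m+1} : |x_{m+1}-x_i|\le r\},\qquad \mathcal{T}=\mathcal{T}_1\cup\cdots\cup\mathcal{T}_m.$$ The game $(P^1)$ has target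 $\mathcal{T}$, and $(P^1_i)$ has target $\mathcal{T}_i$. The pay-off is the first entry time $\tau$ of the state trajectory into the target ($\tau=\inf\{t\ge0 : x(t)\in\text{target}\}$, $=+\infty$ if the target is never reached). The upper value at initial state $x$ is $\sup_{\phi\in\Phi}\inf_{b\in\mathcal{B}}\tau$, where $\tau$ is computed along the trajectory starting at $x$ with controls $(\phi(b),b)$. **Hamiltonian.** $$F^1(x_1,\ldots,x_{m+1},p_1,\ldots,p_{m+1})=-\sum_{i=1}^mH^i(x_i,p_i)+H^{m+1}(x_{m+1},-p_{m+1})-1,$$ $$H^i(x_i,p_i)=\sup_{a_i\in A_i}p_i\,f_i(x_i,a_i)\ (i=1,\ldots,m),\qquad H^{m+1}(x_{m+1},p_{m+1})=\sup_{b_1\in B_1}p_{m+1}\,f_{m+1}(x_{m+1},b_1).$$ The functions $H^1,\dots,H^{m+1}$ are assumed real-valued, and $F^1$ is assumed continuous. **Viscosity solutions.** For a continuous $u$ on an open set $\Omega\subset\mathbb{R}^N$ and $x\in\Omega$, $D^+u(x)=\{p\in\mathbb{R}^N:\limsup_{y\to x}\frac{u(y)-u(x)-p\cdot(y-x)}{|x-y|}\le0\}$ and $D^-u(x)=\{p\in\mathbb{R}^N:\liminf_{y\to x}\frac{u(y)-u(x)-p\cdot(y-x)}{|x-y|}\ge0\}$. A function $u:\Omega\to\mathbb{R}$ is a continuous viscosity solution of $F(x,Du)=0$ on $\Omega$ if it is continuous and, for every $x\in\Omega$, $F(x,p)\le0$ for all $p\in D^+u(x)$ and $F(x,p)\ge0$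 for all $p\in D^-u(x)$. *)

(* Defs.v *)
From mathcomp Require Import all_boot all_order all_algebra.
From mathcomp Require Import all_classical all_reals all_analysis.

Set Implicit Arguments.
Unset Strict Implicit.
Unset Printing Implicit Defensive.

Import Order.TTheory GRing.Theory Num.Theory.
Import numFieldNormedType.Exports.

Local Open Scope classical_set_scope.
Local Open Scope ring_scope.

(* The state (x_1, ..., x_{m+1}) is a row vector indexed by 'I_m.+1: evader
   number i : 'I_m sits at index [evader i], which has the same value as i, and
   the pursuer sits at the last index. *)
Definition state (R : realType) (m : nat) := 'rV[R]_m.+1.

Definition evader (m : nat) (i : 'I_m) : 'I_m.+1 := lift ord_max i.

Definition pursuer (m : nat) : 'I_m.+1 := ord_max.
Arguments pursuer {m}.

Record game (R : realType) (m : nat) := Game {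
  ev_dim : 'I_m -> nat;
  ev_field : forall i : 'I_m, R -> 'rV[R]_(ev_dim i) -> R;
  ev_ctrl : forall i : 'I_m, set 'rV[R]_(ev_dim i);
  pu_dim : nat;
  pu_field : R -> 'rV[R]_pu_dim -> R;
  pu_ctrl : set 'rV[R]_pu_dim;
  cap_radius : R
}.
Arguments ev_field {R m} g i _ _.
Arguments ev_ctrl {R m} g i _.
Arguments pu_field {R m} g _ _.
Arguments pu_ctrl {R m} g _.

(* Functions of time are total on R; only their restriction to [0, +oo[ is
   ever constrained or used. *)
Section real_functions.
Variable R : realType.
Notation mu := (@lebesgue_measure R).

(* R with the Lebesgue (completed Borel) sigma-algebra *)
Definition lebesgueTypeR := caratheodory_type ((@wlength R idfun)^*)%mu.

Definition measurable_ctrl (n : nat) (c : R -> 'rV[R]_n) :=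
  forall k : 'I_n,
    measurable_fun (`[0, +oo[%classic : set lebesgueTypeR)
      (fun t : lebesgueTypeR => c t 0 k).

Definition admissible (n : nat) (C : set 'rV[R]_n) (c : R -> 'rV[R]_n) :=
  measurable_ctrl c /\ {ae mu, forall t : R, 0 <= t -> C (c t)}.

Definition ae_eq_upto (T : Type) (t' : R) (c c' : R -> T) :=
  {ae mu, forall t : R, 0 <= t <= t' -> c t = c' t}.

Definition absolutely_continuous_on (a b : R) (g : R -> R) :=
  forall e : R, 0 < e -> exists2 d : R, 0 < d &
    forall (n : nat) (p q : 'I_n -> R),
      (forall k, a <= p k /\ p k <= q k /\ q k <= b) ->
      trivIset [set: 'I_n] (fun k => `]p k, q k[%classic) ->
      \sum_(k < n) (q k - p k) < d ->
      \sum_(k < n) `|g (q k) - g (p k)| < e.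

End real_functions.

Section game_values.
Variables (R : realType) (m : nat) (G : game R m).
Notation mu := (@lebesgue_measure R).

Definition ev_policy := forall i : 'I_m, R -> 'rV[R]_(ev_dim G i).
Definition pu_policy := R -> 'rV[R]_(pu_dim G).

Definition ev_policies : set ev_policy :=
  [set a | forall i, admissible (ev_ctrl G i) (a i)].

Definition pu_policies : set pu_policy := [set b | admissible (pu_ctrl G) b].

Definition nonanticipative : set (pu_policy -> ev_policy) :=
  [set phi | (forall b, pu_policies b -> ev_policies (phi b)) /\
    forall t' : R, 0 <= t' -> forall b b', pu_policies b -> pu_policies b' ->
      ae_eq_upto t' b b' ->
      forall i, ae_eq_upto t' (phi b i) (phi b' i)].

(* [0 < t] rather than [0 <= t] because [is_derive] is two-sided. *)
Definition trajectory (a : ev_policy) (b : pu_policy) (x0 : state R m) :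
    set (R -> state R m) :=
  [set x | [/\ x 0 = x0,
    (forall (T : R) (k : 'I_m.+1), 0 <= T ->
       absolutely_continuous_on 0 T (fun t => x t 0 k)),
    (forall i : 'I_m, {ae mu, forall t : R, 0 < t ->
       is_derive (t : R) (1 : R) (fun s : R => x s 0 (evader i) : R)
         (ev_field G i (x t 0 (evader i)) (a i t))}) &
    {ae mu, forall t : R, 0 < t ->
       is_derive (t : R) (1 : R) (fun s : R => x s 0 pursuer : R)
         (pu_field G (x t 0 pursuer) (b t))}]].

Definition well_posed :=
  forall a b x0, ev_policies a -> pu_policies b ->
    (exists x, trajectory a b x0 x) /\
    forall x y, trajectory a b x0 x -> trajectory a b x0 y ->
      forall t : R, 0 <= t -> x t = y t.

Definition target_of (i : 'I_m) : set (state R m) :=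
  [set x | `|x 0 pursuer - x 0 (evader i)| <= cap_radius G].

Definition target : set (state R m) := \bigcup_(i in [set: 'I_m]) target_of i.

Definition entry_time (T : set (state R m)) (x : R -> state R m) : \bar R :=
  ereal_inf [set t%:E | t in [set t : R | 0 <= t /\ T (x t)]].

(* The infimum over b runs over all pairs (b, x) with x a trajectory driven by
   (phi b, b): under [well_posed] x exists and is determined by b on
   [0, +oo[, so this is the infimum over b of the entry time. *)
Definition upper_value (T : set (state R m)) (x0 : state R m) : \bar R :=
  ereal_sup [set
    ereal_inf [set entry_time T bx.2 | bx in
      [set bx : pu_policy * (R -> state R m) |
        pu_policies bx.1 /\ trajectory (phi bx.1) bx.1 x0 bx.2]]
    | phi in nonanticipative].

Definition ev_hamiltonian (i : 'I_m) (y p : R) : \bar R :=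
  ereal_sup [set (p * ev_field G i y a)%:E | a in ev_ctrl G i].

Definition pu_hamiltonian (y p : R) : \bar R :=
  ereal_sup [set (p * pu_field G y b)%:E | b in pu_ctrl G].

Definition hamiltonians_real :=
  (forall i y p, ev_hamiltonian i y p \is a fin_num) /\
  (forall y p, pu_hamiltonian y p \is a fin_num).

(* [fine] is harmless under [hamiltonians_real]. *)
Definition hamiltonian (x p : state R m) : R :=
  - (\sum_(i < m) fine (ev_hamiltonian i (x 0 (evader i)) (p 0 (evader i))))
  + fine (pu_hamiltonian (x 0 pursuer) (- p 0 pursuer)) - 1.

End game_values.

Section viscosity.
Variables (R : realType) (n : nat).
Notation X := ('rV[R]_n.+1).

Definition dotp (x y : X) : R := \sum_(k < n.+1) x 0 k * y 0 k.

(* The library norm on row vectors is the sup norm. *)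
Definition euclidean_norm (x : X) : R := Num.sqrt (dotp x x).

Definition diff_quotient (u : X -> R) (x p y : X) : \bar R :=
  ((u y - u x - dotp p (y - x)) / euclidean_norm (x - y))%:E.

(* x^' filters on y tending to x with y != x. For x in an open set Omega these
   only depend on the values of u in Omega. *)
Definition superdiff (u : X -> R) (x : X) : set X :=
  [set p | (limf_esup (diff_quotient u x p) x^' <= 0)%E].

Definition subdiff (u : X -> R) (x : X) : set X :=
  [set p | (0 <= limf_einf (diff_quotient u x p) x^')%E].

(* An extended-real function is a solution when it is real-valued on Omega
   and its real-valued version is a solution. *)
Definition viscosity_solution (Omega : set X) (F : X -> X -> R)
    (u : X -> \bar R) :=
  [/\ forall x, Omega x -> u x \is a fin_num,
      {within Omega, continuous (fine \o u)},
      forall x, Omega x -> forall p, superdiff (fine \o u) x p -> F x p <= 0 &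
      forall x, Omega x -> forall p, subdiff (fine \o u) x p -> 0 <= F x p].

End viscosity.

(* Main.v *)
Require Import Defs.
From mathcomp Require Import all_boot all_order all_algebra.
From mathcomp Require Import all_classical all_reals all_analysis.
From mathcomp Require Import ring lra.
Import Order.TTheory GRing.Theory Num.Theory.
Import numFieldNormedType.Exports.
Local Open Scope classical_set_scope.
Local Open Scope ring_scope.

Set Implicit Arguments.
Unset Strict Implicit.
Unset Printing Implicit Defensive.

(** Why the minimum of the values solves the same equation.

    Continuity and the supersolution inequality are soft: a subgradient of the
    minimum at x is a subgradient of any u_i attaining it at x.

    The subsolution inequality is not soft, because a minimum of subsolutions
    need not be a subsolution. Two facts save it.

    The first is nonsmooth calculus. Where several Lipschitz functions attain the
    minimum, a supergradient p of the minimum is approximately a convex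
    combination of supergradients q_i, one for each function, at nearby points
    (fuzzy_min_rule). It is proved by penalizing the distances to the hypographs
    and reading off the optimality conditions at a maximum. If only one u_i
    attains the minimum, p is a supergradient of that u_i.

    The second is the structure of the game. The dynamics are decoupled and the
    i-th target only involves evader i and the pursuer, so u_i does not depend on
    the other evaders (upper_value_own_coords) and q_i vanishes in their
    coordinates (superdiff_value_coord0). On such families the Hamiltonian is
    convex: each concave term -H^i sees a single vector c_i q_i and is positively
    homogeneous, while the pursuer's term is sublinear
    (hamiltonian_convex_comb). Hence F(x, sum c_i q_i) <= sum c_i F(x, q_i).

    Each F(y_i, q_i) is nonpositive at the nearby points y_i. The Lipschitz bound
    confines the q_i to a fixed ball, where the continuity of F is uniform, so
    replacing y_i by x and the convex combination by p costs arbitrarily little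
    (hamiltonian_superdiff_min). *)

(** * Row vectors, the dot product and norms *)

Lemma entry_le_norm (R : realType) (n : nat) (x : 'rV[R]_n) (k : 'I_n) :
  `|x 0 k| <= `|x|.
Proof.
rewrite [leRHS]/Num.norm /= mx_normrE.
by apply/bigmax_geP; right => /=; exists (0, k).
Qed.

Lemma row_norm_le (R : realType) (n : nat) (x : 'rV[R]_n) (e : R) :
  0 <= e -> (forall k, `|x 0 k| <= e) -> `|x| <= e.
Proof.
move=> e0 xe; rewrite [leLHS]/Num.norm /= mx_normrE.
by apply/bigmax_leP; split => //= -[i j] _ /=; rewrite ord1.
Qed.

Lemma norm_scale_delta (R : realType) (n : nat) (t : R) (k : 'I_n) :
  `|t *: delta_mx 0 k : 'rV[R]_n| <= `|t|.
Proof.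
rewrite normrZ ler_piMr// row_norm_le// => i; rewrite mxE.
by case: (_ && _); rewrite ?normr0 ?normr1.
Qed.

Lemma dotpDr (R : realType) (n : nat) (p x y : 'rV[R]_n.+1) :
  dotp p (x + y) = dotp p x + dotp p y.
Proof. by rewrite -big_split; apply: eq_bigr => k _; rewrite mxE mulrDr. Qed.

Lemma dotpZr (R : realType) (n : nat) (a : R) (p x : 'rV[R]_n.+1) :
  dotp p (a *: x) = a * dotp p x.
Proof. by rewrite mulr_sumr; apply: eq_bigr => k _; rewrite mxE mulrCA. Qed.

Lemma dotp0r (R : realType) (n : nat) (p : 'rV[R]_n.+1) : dotp p 0 = 0.
Proof. by rewrite -(scale0r 0) dotpZr mul0r. Qed.

Lemma dotpC (R : realType) (n : nat) (x y : 'rV[R]_n.+1) :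
  dotp x y = dotp y x.
Proof. by apply: eq_bigr => k _; rewrite mulrC. Qed.

Lemma dotpNr (R : realType) (n : nat) (p x : 'rV[R]_n.+1) :
  dotp p (- x) = - dotp p x.
Proof. by rewrite -scaleN1r dotpZr mulN1r. Qed.

Lemma dotp_delta (R : realType) (n : nat) (p : 'rV[R]_n.+1) (k : 'I_n.+1) :
  dotp p (delta_mx 0 k) = p 0 k.
Proof.
rewrite /dotp (bigD1 k)//= mxE !eqxx mulr1 big1 ?addr0// => j jk.
by rewrite mxE (negbTE jk) andbF mulr0.
Qed.

Lemma dotp_normM (R : realType) (n : nat) (p x : 'rV[R]_n.+1) :
  `|dotp p x| <= n.+1%:R * `|p| * `|x|.
Proof.
apply: (le_trans (ler_norm_sum _ _ _)).
apply: (@le_trans _ _ (\sum_(k < n.+1) `|p| * `|x|)).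
  by apply: ler_sum => k _; rewrite normrM ler_pM ?entry_le_norm.
by rewrite sumr_const card_ord mulr_natl mulrnAl.
Qed.

Lemma norm_le_dotp (R : realType) (n : nat) (x : 'rV[R]_n.+1) :
  `|x| ^+ 2 <= dotp x x.
Proof.
have dx0 : 0 <= dotp x x by apply: sumr_ge0 => k _; rewrite -expr2 sqr_ge0.
rewrite -[leRHS](sqr_sqrtr dx0) ler_sqr ?nnegrE ?sqrtr_ge0//.
apply: row_norm_le => [|k]; first exact: sqrtr_ge0.
rewrite -sqrtr_sqr ler_sqrt// /dotp (bigD1 k)//= -expr2 lerDl.
by apply: sumr_ge0 => j _; rewrite -expr2 sqr_ge0.
Qed.

Lemma dotp_self_ge0 (R : realType) (n : nat) (x : 'rV[R]_n.+1) : 0 <= dotp x x.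
Proof. by apply: sumr_ge0 => k _; rewrite -expr2 sqr_ge0. Qed.

Lemma dotp_self_le (R : realType) (n : nat) (x : 'rV[R]_n.+1) :
  dotp x x <= n.+1%:R * `|x| ^+ 2.
Proof.
apply: (le_trans (ler_norm _)); apply: (le_trans (dotp_normM _ _)).
by rewrite expr2 mulrA.
Qed.

Lemma dotp_selfD (R : realType) (n : nat) (x y : 'rV[R]_n.+1) :
  dotp (x + y) (x + y) = dotp x x + 2 * dotp x y + dotp y y.
Proof.
by rewrite dotpDr ![dotp (x + y) _]dotpC !dotpDr [dotp y x]dotpC; ring.
Qed.

Lemma dotp_continuous (R : realType) (n : nat) (p : 'rV[R]_n.+1) :
  continuous (dotp p).
Proof.
move=> x; apply: (cvg_big add_continuous (nbhs_filter x)) => k _.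
by apply: cvgM; [exact: cvg_cst|exact: coord_continuous].
Qed.

Lemma dotp_self_continuous (R : realType) (n : nat) :
  continuous (fun x : 'rV[R]_n.+1 => dotp x x).
Proof.
move=> x; apply: (cvg_big add_continuous (nbhs_filter x)) => k _.
by apply: cvgM; exact: coord_continuous.
Qed.

Lemma norm_le_euclidean (R : realType) (n : nat) (x : 'rV[R]_n.+1) :
  `|x| <= euclidean_norm x.
Proof.
rewrite -[leLHS]ger0_norm// -sqrtr_sqr /euclidean_norm ler_sqrt ?norm_le_dotp//.
by apply: sumr_ge0 => k _; rewrite -expr2 sqr_ge0.
Qed.

Lemma euclidean_le_norm (R : realType) (n : nat) (x : 'rV[R]_n.+1) :
  euclidean_norm x <= n.+1%:R * `|x|.
Proof.
have n1 : (1 : R) <= n.+1%:R by rewrite ler1n.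
rewrite -[leRHS]ger0_norm ?mulr_ge0// -sqrtr_sqr /euclidean_norm ler_sqrt ?sqr_ge0//.
apply: (le_trans (ler_norm _)); apply: (le_trans (dotp_normM _ _)).
by rewrite exprMn !expr2 mulrA ler_wpM2r// ler_wpM2r// ler_peMr.
Qed.

Lemma nbhs_closed_ball (R : realType) (n : nat) (x : 'rV[R]_n) (V : set 'rV[R]_n) :
  nbhs x V -> exists2 rho : R, 0 < rho & forall y, `|y - x| <= rho -> V y.
Proof.
move=> /nbhs_ballP[r /= r0 rV]; exists (r / 2); first by rewrite divr_gt0.
move=> y yx; apply: rV; rewrite mx_norm_ball /ball_ /= distrC.
by apply: le_lt_trans yx _; rewrite ltr_pdivrMr// ltr_pMr// ltr1n.
Qed.

(** * Super- and subdifferentials *)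

(** First-order optimality with a kink: dividing by t and letting t tend to 0
    from both sides kills the quadratic term. *)
Lemma linear_le_quadratic (R : realType) (t0 a b C : R) :
  0 < t0 -> 0 <= b -> 0 <= C ->
  (forall t, `|t| <= t0 -> a * t <= b * `|t| + C * t ^+ 2) -> `|a| <= b.
Proof.
move=> t00 b0 C0 H; apply/ler_addgt0Pr => e e0.
pose t := Num.min t0 (e / (C + 1)).
have C1 : 0 < C + 1 by rewrite ltr_wpDl.
have t_gt0 : 0 < t by rewrite lt_min t00 divr_gt0.
have tt0 : t <= t0 by rewrite ge_min lexx.
have te : C * t <= e.
  have : t <= e / (C + 1) by rewrite ge_min lexx orbT.
  rewrite ler_pdivlMr// mulrDr mulr1 mulrC; apply: le_trans.
  by rewrite lerDl ltW.
have nt : `|t| = t by rewrite gtr0_norm.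
have H1 := H t; have H2 := H (- t).
rewrite normrN nt tt0 in H1 H2; move: (H1 isT) (H2 isT) => {}H1 {}H2.
rewrite sqrrN in H2; rewrite ler_norml; apply/andP; split.
  rewrite -(ler_pM2r t_gt0); rewrite expr2 in H2; nra.
rewrite -(ler_pM2r t_gt0); rewrite expr2 in H1; nra.
Qed.

(** The difference quotients are normalized by the Euclidean norm, the topology
    by the sup norm; the two are equivalent and the statement below, in which
    the puncture of the neighbourhood has also disappeared, is the form in
    which superdifferentials are used. *)
Lemma superdiffP (R : realType) (n : nat) (u : 'rV[R]_n.+1 -> R)
    (x p : 'rV[R]_n.+1) :
  superdiff u x p <->
  forall e : R, 0 < e ->
    \forall y \near x, u y <= u x + dotp p (y - x) + e * `|y - x|.
Proof.
split=> [up e e0|up].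
  pose e' := e / n.+1%:R; have e'0 : 0 < e' by rewrite divr_gt0.
  have /ereal_inf_lt[_ [V Vx <-] Ve] :
    (limf_esup (diff_quotient u x p) x^' < e'%:E)%E by exact: le_lt_trans up _.
  have : \forall y \near x, y != x -> V y by exact: Vx.
  apply: filterS => y Vy.
  have [->|yx] := eqVneq y x.
    by rewrite subrr normr0 dotp0r mulr0 !addr0.
  have : (diff_quotient u x p y < e'%:E)%E.
    apply: le_lt_trans Ve; apply: ereal_sup_ubound; exists y => //; exact: Vy.
  have xy0 : 0 < `|x - y| by rewrite normr_gt0 subr_eq0 eq_sym.
  have E0 : 0 < euclidean_norm (x - y) := lt_le_trans xy0 (norm_le_euclidean _).
  rewrite lte_fin ltr_pdivrMr// => /ltW H.
  have : e' * euclidean_norm (x - y) <= e * `|y - x|.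
    rewrite /e' -mulrA ler_wpM2l ?(ltW e0)//.
    by rewrite ler_pdivrMl ?ltr0n// distrC euclidean_le_norm.
  by lra.
apply/lee_addgt0Pr => e e0; rewrite add0e.
apply: ge_ereal_inf; exists (ereal_sup (diff_quotient u x p @`
  [set y | y != x /\ u y <= u x + dotp p (y - x) + e * `|y - x|])).
  eexists; last reflexivity.
  rewrite /dnbhs /within /=; near=> y; move=> yx; split => //.
  by near: y; exact: up.
apply: ge_ereal_sup => _ [y [yx H]] <-; rewrite lee_fin.
have xy0 : 0 < `|x - y| by rewrite normr_gt0 subr_eq0 eq_sym.
have E0 : 0 < euclidean_norm (x - y) := lt_le_trans xy0 (norm_le_euclidean _).
rewrite ler_pdivrMr//.
have : e * `|y - x| <= e * euclidean_norm (x - y).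
  by rewrite distrC ler_wpM2l ?(ltW e0) ?norm_le_euclidean.
by lra.
Unshelve. all: by end_near.
Qed.

Lemma subdiffN (R : realType) (n : nat) (u : 'rV[R]_n.+1 -> R)
    (x p : 'rV[R]_n.+1) :
  subdiff u x p = superdiff (\- u) x (- p).
Proof.
rewrite /subdiff /superdiff /mkset /limf_einf leeNr oppe0.
suff -> : (\- diff_quotient u x p)%E = diff_quotient (\- u) x (- p) by [].
apply/funext => y; rewrite /diff_quotient /=; congr (_%:E).
rewrite -mulNr; congr (_ / _).
by rewrite ![dotp _ (y - x)]dotpC dotpNr; ring.
Qed.

Lemma subdiffP (R : realType) (n : nat) (u : 'rV[R]_n.+1 -> R)
    (x p : 'rV[R]_n.+1) :
  subdiff u x p <->
  forall e : R, 0 < e ->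
    \forall y \near x, u x + dotp p (y - x) - e * `|y - x| <= u y.
Proof.
rewrite subdiffN superdiffP.
by split=> up e /up; apply: filterS => y;
  rewrite ![dotp _ (y - x)]dotpC dotpNr /=; lra.
Qed.

(** A one-sided quadratic bound on some ball is how the variational argument
    produces superdifferentials. *)
Lemma superdiff_quadratic (R : realType) (n : nat) (u : 'rV[R]_n.+1 -> R) y q rho C :
  0 < rho -> 0 <= C ->
  (forall w, `|w - y| <= rho -> u w <= u y + dotp q (w - y) + C * `|w - y| ^+ 2) ->
  superdiff u y q.
Proof.
move=> rho0 C0 H; apply/superdiffP => e e0.
have C1 : 0 < C + 1 by rewrite ltr_wpDl.
near=> w.
have w1 : `|w - y| <= rho.
  by rewrite distrC; near: w; apply: cvgr_dist_le; [exact: cvg_id|].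
have w2 : `|w - y| <= e / (C + 1).
  rewrite distrC; near: w; apply: cvgr_dist_le; first exact: cvg_id.
  by rewrite divr_gt0.
apply: le_trans (H w w1) _; rewrite lerD2l expr2 mulrA ler_wpM2r//.
rewrite ler_pdivlMr// mulrDr mulr1 mulrC in w2.
by have := normr_ge0 (w - y); lra.
Unshelve. all: by end_near.
Qed.

(** Testing q along +/- the k-th basis vector. With L = 0 this says that q
    vanishes along directions in which u is constant; with L a Lipschitz
    constant it bounds q. *)
Lemma superdiff_coord_le (R : realType) (n : nat) (u : 'rV[R]_n.+1 -> R)
    (y q : 'rV[R]_n.+1) (k : 'I_n.+1) (rho L : R) :
  0 < rho -> 0 <= L -> superdiff u y q ->
  (forall t, `|t| <= rho -> u y - u (y + t *: delta_mx 0 k) <= L * `|t|) ->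
  `|q 0 k| <= L.
Proof.
move=> rho0 L0 /superdiffP up uL; apply/ler_addgt0Pr => e e0.
have [r r0 Hr] := nbhs_closed_ball (up e e0).
rewrite -normrN; apply: (@linear_le_quadratic _ (Num.min rho r) _ _ 0) => //.
- by rewrite lt_min rho0.
- by rewrite addr_ge0// ltW.
move=> t; rewrite le_min => /andP[trho tr].
have nt := @norm_scale_delta R n.+1 t k.
have := Hr (y + t *: delta_mx 0 k); rewrite addrC addKr => /(_ (le_trans nt tr)).
rewrite dotpZr dotp_delta; have := uL t trho.
have := ler_wpM2l (ltW e0) nt; lra.
Qed.

(** * Penalizing the distance to hypographs *)

Definition overshoot (R : realType) (a : R) : R := Num.max 0 a.

Lemma overshoot_ge0 (R : realType) (a : R) : 0 <= overshoot a.
Proof. by rewrite /overshoot le_max lexx. Qed.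

Lemma overshoot_ge (R : realType) (a : R) : a <= overshoot a.
Proof. by rewrite /overshoot le_max lexx orbT. Qed.

(** The squared positive part is the minimum of (a + s)^2 over s >= 0, so it
    lies below the parabola that is tangent to it at a. This replaces
    differentiating it. *)
Lemma overshoot_sqrD (R : realType) (a h : R) :
  overshoot (a + h) ^+ 2 <= (overshoot a + h) ^+ 2.
Proof.
rewrite /overshoot; case: (leP 0 a) => a0; case: (leP 0 (a + h)) => ah0 //.
- by rewrite expr0n sqr_ge0.
- by rewrite add0r ler_sqr ?nnegrE//; lra.
- by rewrite expr0n sqr_ge0.
Qed.

Lemma overshoot_sqr_continuous (R : realType) :
  continuous (fun a : R => overshoot a ^+ 2).
Proof.
move=> a; have ca : {for a, continuous (@overshoot R)}.
  apply: (@continuous_max R R (cst 0) id a); [exact: cvg_cst|exact: cvg_id].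
exact: (cvgM ca ca).
Qed.

(** The infimum over y is the squared distance from (z, r) to the hypograph of u. *)
Definition hypo_penalty (R : realType) (n : nat) (u : 'rV[R]_n.+1 -> R)
    (y z : 'rV[R]_n.+1) (r : R) : R :=
  overshoot (r - u y) ^+ 2 + dotp (y - z) (y - z).

Lemma hypo_penalty_moveh (R : realType) (n : nat) (u : 'rV[R]_n.+1 -> R) y z r h :
  hypo_penalty u y z (r + h) <=
  hypo_penalty u y z r + 2 * overshoot (r - u y) * h + h ^+ 2.
Proof.
rewrite /hypo_penalty (_ : r + h - u y = (r - u y) + h); last by ring.
by have := overshoot_sqrD (r - u y) h; rewrite sqrrD; lra.
Qed.

Lemma hypo_penalty_movez (R : realType) (n : nat) (u : 'rV[R]_n.+1 -> R) y z r h :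
  hypo_penalty u y (z + h) r =
  hypo_penalty u y z r - 2 * dotp (y - z) h + dotp h h.
Proof.
rewrite /hypo_penalty opprD addrA (dotp_selfD (y - z) (- h)) !dotpNr.
by rewrite [dotp (- h) h]dotpC dotpNr; ring.
Qed.

Lemma hypo_penalty_movey (R : realType) (n : nat) (u : 'rV[R]_n.+1 -> R) y z r y' :
  hypo_penalty u y' z r <=
  hypo_penalty u y z r - 2 * overshoot (r - u y) * (u y' - u y) +
    (u y' - u y) ^+ 2 + 2 * dotp (y - z) (y' - y) + dotp (y' - y) (y' - y).
Proof.
have e1 : r - u y' = r - u y + (u y - u y') by ring.
have e2 : y' - z = y - z + (y' - y) by rewrite [RHS]addrC addrA subrK.
rewrite /hypo_penalty e1 e2 (dotp_selfD (y - z)).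
have := overshoot_sqrD (r - u y) (u y - u y').
by rewrite -(sqrrN (u y' - u y)) opprB sqrrD; lra.
Qed.

Lemma hypo_penalty_ge (R : realType) (n : nat) (u : 'rV[R]_n.+1 -> R) y z r :
  overshoot (r - u y) ^+ 2 + `|y - z| ^+ 2 <= hypo_penalty u y z r.
Proof. by rewrite lerD2l norm_le_dotp. Qed.

Lemma row_entry_continuous (R : realType) (n k : nat) (i : 'I_k) :
  continuous (fun y : 'rV['rV[R]_n]_k => y 0 i).
Proof.
move=> M s /= /(nbhs_ballP (M 0 i)) [e e0 es].
by apply/nbhs_ballP; exists e => //= N [_ MN]; exact/es/MN.
Qed.

(** Compactness: y ranges over a finite product of balls, z over a ball and r
    over a segment. *)
Lemma penalized_max (R : realType) (n k : nat) (u : 'I_k -> 'rV[R]_n.+1 -> R)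
    (P : pred 'I_k) (x0 : 'rV[R]_n.+1) (rho L c B N : R)
    (phi : 'rV[R]_n.+1 -> R) :
  0 < rho -> 0 < B -> continuous phi ->
  (forall i, P i -> forall y z, `|y - x0| <= rho -> `|z - x0| <= rho ->
    `|u i y - u i z| <= L * `|y - z|) ->
  let box (w : ('I_k -> 'rV[R]_n.+1) * 'rV[R]_n.+1 * R) :=
    [/\ forall i, `|w.1.1 i - x0| <= rho, `|w.1.2 - x0| <= rho &
        `|w.2 - c| <= B] in
  let Psi (w : ('I_k -> 'rV[R]_n.+1) * 'rV[R]_n.+1 * R) :=
    w.2 - phi w.1.2 - N * \sum_(i | P i) hypo_penalty (u i) (w.1.1 i) w.1.2 w.2 in
  exists2 w, box w & forall w', box w' -> Psi w' <= Psi w.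
Proof.
move=> rho0 B0 cphi lipu box Psi.
pose D := ('rV['rV[R]_n.+1]_k * 'rV[R]_n.+1 * R)%type.
pose f (v : D) : ('I_k -> 'rV[R]_n.+1) * 'rV[R]_n.+1 * R :=
  ((fun i => v.1.1 0 i), v.1.2, v.2).
pose ballK : set 'rV[R]_n.+1 := closed_ball x0 rho.
have ballE y : ballK y = (`|y - x0| <= rho).
  by rewrite /ballK closed_ballE// /closed_ball_ /= distrC.
have cball : compact ballK.
  apply: bounded_closed_compact; last by apply: closed_ball_closed.
  exists (`|x0| + rho); split; first exact: num_real.
  move=> M' M'x y; rewrite /= ballE => yx; apply: le_trans (ltW M'x).
  rewrite -[y](subrK x0) addrC; apply: (le_trans (ler_normD _ _)).
  by rewrite lerD2l.
pose K : set D := ([set y : 'rV['rV[R]_n.+1]_k |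
    forall i, ballK (y ord0 i)] `*` ballK) `*`
  `[c - B, c + B]%classic.
have KE v : K v <-> box (f v).
  rewrite /K /box /=; split.
    move=> [[/= h1 h2] h3]; split.
    - by move=> i; rewrite -ballE.
    - by rewrite -ballE.
    - by rewrite ler_distl; move: h3; rewrite in_itv.
  move=> [h1 h2 h3]; split; first split => /=.
  - by move=> i; rewrite ballE.
  - by rewrite ballE.
  - by rewrite /= in_itv /= -ler_distl.
have cK : compact K.
  apply: compact_setX; last exact: segment_compact.
  by apply: compact_setX => //; apply: (@rV_compact _ _ (fun=> ballK)).
have K0 : K !=set0.
  exists (\row_i x0, x0, c); apply/KE; split => /= [i||]; rewrite ?mxE subrr normr0;
    exact: ltW.
have [|v vK vmax] := @compact_EVT_max D R (Psi \o f) K K0 cK.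
  apply/subspace_continuousP => v Kv.
  have FF : Filter (within K (nbhs v)) by exact: within_filter.
  have c11 : (fun w : D => w.1.1) @ within K (nbhs v) --> v.1.1.
    apply: cvg_within_filter.
    exact: (@cvg_comp D _ _ fst fst _ _ _ cvg_fst cvg_fst).
  have c12 : (fun w : D => w.1.2) @ within K (nbhs v) --> v.1.2.
    apply: cvg_within_filter.
    exact: (@cvg_comp D _ _ fst snd _ _ _ cvg_fst cvg_snd).
  have c2 : (fun w : D => w.2) @ within K (nbhs v) --> v.2.
    apply: cvg_within_filter; exact: cvg_snd.
  have cy i : (fun w : D => w.1.1 0 i) @ within K (nbhs v) --> v.1.1 0 i.
    exact: (cvg_comp _ _ c11 (@row_entry_continuous _ _ _ i v.1.1)).
  (* The u i are only controlled on the ball, hence the limits within K. *)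
  have cu i : P i -> (fun w : D => u i (w.1.1 0 i)) @ within K (nbhs v)
      --> u i (v.1.1 0 i).
    move=> Pi; apply/cvgrPdist_le => e e0.
    have /cvgrPdist_le/(_ (e / (`|L| + 1))) := cy i.
    rewrite divr_gt0// ?ltr_wpDl// => /(_ isT) cyi.
    have inK : \forall w \near within K (nbhs v), K w by exact: withinT.
    apply: filterS2 cyi inK => w cyi /KE [/= wi _ _].
    have /KE [/= vi _ _] := Kv.
    apply: (le_trans (lipu i Pi _ _ (vi i) (wi i))).
    move: cyi; rewrite ler_pdivlMr ?ltr_wpDl// => cyi.
    have := ler_wpM2r (normr_ge0 (v.1.1 0 i - w.1.1 0 i)) (ler_norm L).
    have := normr_ge0 (v.1.1 0 i - w.1.1 0 i).
    rewrite mulrDr mulr1 in cyi.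
    by rewrite mulrC; lra.
  have ch i : P i -> (fun w : D => hypo_penalty (u i) (w.1.1 0 i) w.1.2 w.2)
      @ within K (nbhs v) --> hypo_penalty (u i) (v.1.1 0 i) v.1.2 v.2.
    move=> Pi; apply: cvgD.
      have co := cvgB c2 (cu i Pi).
      exact: (@cvg_comp D R R _ (fun a => overshoot a ^+ 2) _ _ _ (co FF)
        (@overshoot_sqr_continuous R _)).
    have cyz := cvgB (cy i) c12.
    exact: (@cvg_comp D _ R _ (fun a => dotp a a) _ _ _ (cyz FF)
      (@dotp_self_continuous R n _)).
  have cS := @cvg_big _ _ _ 0 P add_continuous D _ (index_enum _) _ _ FF ch.
  apply: cvgB; last by apply: cvgM; [exact: cvg_cst|exact: cS].
  by apply: cvgB; [exact: c2|exact: (cvg_comp _ _ c12 (cphi _))].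
exists (f v); first by apply/KE; exact: set_mem.
move=> [[y z] r] bw.
have fw : f (\row_i y i, z, r) = (y, z, r).
  by rewrite /f /=; congr (_, _, _); apply/funext => i; rewrite mxE.
have := vmax (\row_i y i, z, r); rewrite /= fw; apply.
by apply/mem_set/KE; rewrite fw.
Qed.

(** * Superdifferentials of a minimum *)

(** A fuzzy form of Mordukhovich's rule for the superdifferential of a minimum:
    a supergradient p of min u_i at x0 is, up to 2e, a convex combination with
    exactly one supergradient of each u_i involved, taken at a nearby point.
    That there is only one per function matters, because the Hamiltonian is not
    convex in the gradient of a single u_i.

    Geometrically the hypograph of the minimum is the intersection of the
    hypographs, and p gives a direction normal to it at (x0, c). Maximize
      r - p.(z - x0) - 2e|z - x0|
        - N sum_i ( ((r - u_i(y_i))^+)^2 + |y_i - z|^2 ).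
    With d_i = (r - u_i(y_i))^+ at the maximum, optimality in r gives
    sum_i 2 N d_i = 1, so lam_i = 2 N d_i are the weights; optimality in y_i says
    that (y_i - z) / d_i is a supergradient q_i of u_i at y_i when d_i > 0, and
    y_i = z otherwise; optimality in z says that sum_i 2 N (y_i - z), which is
    sum_i lam_i q_i, is within 2e of p. *)
Lemma fuzzy_min_rule (R : realType) (n k : nat) (u : 'I_k -> 'rV[R]_n.+1 -> R)
    (P : pred 'I_k) (x0 p : 'rV[R]_n.+1) (rho L c e : R) :
  0 < rho -> 0 <= L -> 0 < e ->
  (forall i, P i -> forall y z, `|y - x0| <= rho -> `|z - x0| <= rho ->
    `|u i y - u i z| <= L * `|y - z|) ->
  (forall i, P i -> c <= u i x0) ->
  (forall y, `|y - x0| <= rho -> exists2 i, P i &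
    u i y <= c + dotp p (y - x0) + e * `|y - x0|) ->
  exists (Q : pred 'I_k) (lam : 'I_k -> R) (y q : 'I_k -> 'rV[R]_n.+1),
    [/\ forall i, Q i -> P i /\ 0 < lam i,
        \sum_(i | Q i) lam i = 1,
        forall i, Q i -> `|y i - x0| < rho,
        forall i, Q i -> superdiff (u i) (y i) (q i) &
        `|p - \sum_(i | Q i) lam i *: q i| <= 2 * e].
Proof.
move=> rho0 L0 e0 lipu cu above.
pose phi z := dotp p (z - x0) + 2 * e * `|z - x0|.
have cphi : continuous phi.
  move=> z; have cz : (fun z' : 'rV[R]_n.+1 => z' - x0) @ z --> z - x0.
    exact: (cvgB cvg_id (cvg_cst x0)).
  have c1 : {for z, continuous (fun z' : 'rV[R]_n.+1 => dotp p (z' - x0))}.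
    apply: (@continuous_comp _ _ _ (fun z' : 'rV[R]_n.+1 => z' - x0) (dotp p)) => //.
    exact: dotp_continuous.
  have c2 : {for z, continuous (fun z' : 'rV[R]_n.+1 => `|z' - x0|)}.
    exact: (@cvg_norm _ _ _ _ _ (fun z' : 'rV[R]_n.+1 => z' - x0) _ cz).
  exact: (cvgD c1 (cvgM (cvg_cst (2 * e)) c2)).
(* M and N are tuned so that the bounds N S <= M / N and
   2 e |z - x0| <= M / N proved below keep z and every y i strictly inside the
   ball; B is so large that r stays at distance 1 from the ends of its range. *)
pose M := L ^+ 2 + 1.
have M1 : 1 <= M by rewrite lerDr sqr_ge0.
have M0 : 0 < M by apply: lt_le_trans M1.
pose N := 2 * M / rho + M / (e * rho) + 1.
have N0 : 0 < N by rewrite ltr_wpDl// addr_ge0// divr_ge0 ?mulr_ge0// ltW.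
pose B := n.+1%:R * `|p| * rho + e * rho + L * rho + rho + 1.
have B1 : 1 <= B by rewrite lerDr !addr_ge0 ?mulr_ge0// ltW.
have B0 : 0 < B by apply: lt_le_trans B1.
have [w] := @penalized_max _ _ _ u P x0 rho L c B N phi rho0 B0 cphi lipu.
case: w => [[y z] r] [/= yball zball rint] wmax.
pose d i := overshoot (r - u i (y i)).
pose S := \sum_(i | P i) hypo_penalty (u i) (y i) z r.
have hp0 i : 0 <= hypo_penalty (u i) (y i) z r.
  by rewrite addr_ge0 ?sqr_ge0 ?dotp_self_ge0.
have S0 : 0 <= S by apply: sumr_ge0.
have hpS i : P i -> hypo_penalty (u i) (y i) z r <= S.
  by move=> Pi; rewrite /S (bigD1 i)//= lerDl sumr_ge0.
(* The point y = z = x0, r = c lies in all the hypographs, so it pays no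
   penalty and the objective there is c. *)
have base : c <= r - phi z - N * S.
  apply: le_trans (wmax (fun=> x0, x0, c) _) => /=; last first.
    by rewrite !subrr !normr0; split=> [_||]; exact: ltW.
  rewrite /phi subrr normr0 dotp0r mulr0 addr0 subr0 big1 ?mulr0 ?subr0// => i Pi.
  rewrite /hypo_penalty subrr dotp0r addr0 /overshoot max_l ?expr0n//.
  by rewrite subr_le0 cu.
(* Some u i0 lies below the tilted cone at z, hence so does r up to d i0 and
   L |y i0 - z|; these linear terms are absorbed by half of the quadratic
   penalty through Young's inequality, at the price of M / (2 N). *)
have [i0 Pi0 above0] := above z zball.
have key : N * S <= M / N /\ 2 * e * `|z - x0| <= M / N.
  have := hypo_penalty_ge (u i0) (y i0) z r; have := hpS i0 Pi0.
  have := overshoot_ge (r - u i0 (y i0)); rewrite -/(d i0).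
  have := lipu i0 Pi0 _ _ (yball i0) zball; rewrite ler_norml => /andP[_].
  have young (a s : R) : a * s <= (N * s ^+ 2 + a ^+ 2 / N) / 2.
    have : 0 <= (N * s - a) ^+ 2 / N by rewrite divr_ge0 ?sqr_ge0// ltW.
    have -> : (N * s - a) ^+ 2 / N = N * s ^+ 2 - 2 * (a * s) + a ^+ 2 / N.
      by field; rewrite gt_eqF.
    lra.
  have := young L `|y i0 - z|; have := young 1 (d i0).
  have -> : M / N = L ^+ 2 / N + 1 ^+ 2 / N by rewrite /M mulrDl expr1n.
  move: base; rewrite /phi => b y1 y2 li od hs hg.
  have : N * (d i0 ^+ 2 + `|y i0 - z| ^+ 2) <= N * S.
    by rewrite ler_pM2l//; apply: le_trans hg hs.
  have ez : 0 <= e * `|z - x0| by rewrite mulr_ge0// ltW.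
  have NS : 0 <= N * S by rewrite mulr_ge0// ltW.
  by move=> NdS; split; lra.
have [NS ezx0] := key.
have zx0 : `|z - x0| < rho / 2.
  have MN : M / N < e * rho.
    rewrite ltr_pdivrMr// mulrC -ltr_pdivrMr ?mulr_gt0// /N -addrA ltr_wpDl//.
      by rewrite divr_ge0 ?mulr_ge0// ltW.
    by rewrite ltrDl.
  have : e * (2 * `|z - x0|) < e * rho by rewrite mulrCA mulrA (le_lt_trans ezx0).
  by rewrite ltr_pM2l//; lra.
have MN : M / N < rho / 2.
  rewrite ltr_pdivrMr// mulrC -ltr_pdivrMr ?divr_gt0// /N.
  have -> : M / (rho / 2) = 2 * M / rho by field; rewrite gt_eqF.
  by rewrite -addrA ltrDl ltr_wpDl// divr_ge0 ?mulr_ge0// ltW.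
have SMN : S <= (M / N) ^+ 2.
  have NM : 1 <= N * (M / N) by rewrite mulrCA mulfV ?mulr1// gt_eqF.
  have MN0 : 0 < M / N by rewrite divr_gt0.
  apply: (@le_trans _ _ (N * S * (M / N))); last by rewrite expr2 ler_pM2r.
  by rewrite mulrAC ler_peMl.
have near_z i : P i -> d i <= rho / 2 /\ `|y i - z| < rho / 2.
  move=> Pi; have := le_trans (hypo_penalty_ge (u i) (y i) z r) (hpS i Pi).
  have sqr_le (a b : R) : 0 <= a -> 0 <= b -> a ^+ 2 + b ^+ 2 <= S -> a <= M / N.
    move=> a0 b0 abS; rewrite -ler_sqr ?nnegrE ?divr_ge0 ?(ltW M0) ?(ltW N0)//.
    by apply: le_trans SMN; apply: le_trans abS; rewrite lerDl sqr_ge0.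
  move=> dyS; split.
    by apply/ltW/le_lt_trans/MN/(sqr_le _ _ _ _ dyS); rewrite ?overshoot_ge0.
  rewrite addrC in dyS; apply/le_lt_trans/MN/(sqr_le _ _ _ _ dyS) => //.
  exact: overshoot_ge0.
have rB : `|r - c| <= B - 1.
  have [d0 y0z] := near_z i0 Pi0.
  have := overshoot_ge (r - u i0 (y i0)); rewrite -/(d i0).
  have := lipu i0 Pi0 _ _ (yball i0) zball; rewrite ler_norml => /andP[_].
  have : L * `|y i0 - z| <= L * rho by rewrite ler_wpM2l//; lra.
  have : e * `|z - x0| <= e * rho by rewrite ler_wpM2l// ltW.
  have ez : 0 <= e * `|z - x0| by rewrite mulr_ge0// ltW.
  have NS0 : 0 <= N * S by rewrite mulr_ge0// ltW.
  have Lr : 0 <= L * rho by rewrite mulr_ge0// ltW.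
  have er : 0 <= e * rho by rewrite mulr_ge0// ltW.
  have : `|dotp p (z - x0)| <= n.+1%:R * `|p| * rho.
    by apply: le_trans (dotp_normM _ _) _; rewrite ler_wpM2l.
  move: base; rewrite /phi ler_norml => b /andP[] *.
  by rewrite ler_norml /B; apply/andP; split; lra.
have yx0 i : P i -> `|y i - x0| < rho.
  move=> /near_z[_ yz]; apply: le_lt_trans (ler_distD z _ _) _; lra.
have N2 : 0 < 2 * N by rewrite mulr_gt0.
have card0 : 0 <= \sum_(i | P i) (1 : R) by apply: sumr_ge0.
(* Stationarity in the height r. *)
have sumd : \sum_(i | P i) 2 * N * d i = 1.
  apply/eqP; rewrite eq_sym -subr_eq0 -normr_le0.
  apply: (@linear_le_quadratic _ 1 _ 0 (N * \sum_(i | P i) 1)) => //.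
    by rewrite mulr_ge0// ltW.
  move=> t t1; have := wmax (y, z, r + t); rewrite /= => /(_ _).
  have bx : [/\ forall i, `|y i - x0| <= rho, `|z - x0| <= rho & `|r + t - c| <= B].
    split=> //; rewrite addrAC; apply: (le_trans (ler_normD _ _)); lra.
  move=> /(_ bx).
  have : \sum_(i | P i) hypo_penalty (u i) (y i) z (r + t) <=
      S + 2 * (\sum_(i | P i) d i) * t + (\sum_(i | P i) 1) * t ^+ 2.
    rewrite mulrAC mulr_sumr !mulr_suml -!big_split /=; apply: ler_sum => i Pi.
    by have := hypo_penalty_moveh (u i) (y i) z r t; rewrite -/(d i); lra.
  move=> /(ler_wpM2l (ltW N0)); rewrite -mulr_sumr -/S mul0r; lra.
(* Stationarity in z; the cone is not differentiable, whence the error 2 e. *)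
have dz (t : R) (j : 'I_n.+1) : `|t| <= rho / 2 ->
  (2 * N * (\sum_(i | P i) (y i - z) 0 j) - p 0 j) * t <=
    2 * e * `|t| + (N * \sum_(i | P i) 1) * t ^+ 2.
  move=> ht; pose h : 'rV[R]_n.+1 := t *: delta_mx 0 j.
  have nh : `|h| <= `|t| by exact: norm_scale_delta.
  have bx : [/\ forall i, `|y i - x0| <= rho, `|z + h - x0| <= rho & `|r - c| <= B].
    split=> //; rewrite addrAC; apply: (le_trans (ler_normD _ _)); lra.
  have := wmax (y, z + h, r) bx; rewrite /=.
  have -> : \sum_(i | P i) hypo_penalty (u i) (y i) (z + h) r =
      S - 2 * (\sum_(i | P i) (y i - z) 0 j) * t + (\sum_(i | P i) 1) * t ^+ 2.
    rewrite mulrAC mulr_sumr !mulr_suml -sumrN -!big_split /=; apply: eq_bigr => i Pi.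
    rewrite hypo_penalty_movez /h !dotpZr dotp_delta [dotp _ (delta_mx _ _)]dotp_delta.
    by rewrite !mxE !eqxx /=; ring.
  have : phi (z + h) <= phi z + p 0 j * t + 2 * e * `|t|.
    rewrite /phi addrAC dotpDr /h dotpZr dotp_delta -/h.
    have := ler_normD (z - x0) h; rewrite -(ler_pM2l (_ : 0 < 2 * e)) ?mulr_gt0//.
    have : 2 * e * `|h| <= 2 * e * `|t| by rewrite ler_wpM2l// mulr_ge0// ltW.
    by lra.
  by rewrite -/S; nra.
(* Stationarity in y i. *)
have dy i : P i -> forall w, `|w - y i| <= rho - `|y i - x0| ->
    d i * u i w <= d i * u i (y i) + dotp (y i - z) (w - y i) +
      (L ^+ 2 + n.+1%:R) / 2 * `|w - y i| ^+ 2.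
  move=> Pi w wy; have wx0 : `|w - x0| <= rho.
    by apply: le_trans (ler_distD (y i) _ _) _; lra.
  pose y' j := if j == i then w else y j.
  have := wmax (y', z, r); rewrite /= => /(_ _).
  have bx : [/\ forall j, `|y' j - x0| <= rho, `|z - x0| <= rho & `|r - c| <= B].
    split=> // j; rewrite /y'; case: ifP => // _; exact: wx0.
  move=> /(_ bx); rewrite lerD2l lerN2 ler_pM2l//.
  rewrite (bigD1 i)//= [leRHS](bigD1 i)//= {1}/y' eqxx.
  rewrite [X in _ <= _ + X](eq_bigr (fun j => hypo_penalty (u j) (y j) z r)); last first.
    by move=> j /andP[_ /negbTE ji]; rewrite /y' ji.
  rewrite lerD2r; have := hypo_penalty_movey (u i) (y i) z r w; rewrite -/(d i).
  have uL : (u i w - u i (y i)) ^+ 2 <= L ^+ 2 * `|w - y i| ^+ 2.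
    rewrite -exprMn -[leLHS]real_normK ?num_real// ler_sqr ?nnegrE ?mulr_ge0//.
    exact: lipu.
  by have := dotp_self_le (w - y i); lra.
(* When d i = 0 the stationarity in y i forces y i = z, so that the identity
   survives the convention 0^-1 = 0. *)
have dq i : P i -> 2 * N * d i *: ((d i)^-1 *: (y i - z)) = 2 * N *: (y i - z).
  move=> Pi; have [d0|d0] := eqVneq (d i) 0; last first.
    by rewrite scalerA -mulrA mulfV// mulr1.
  rewrite d0 mulr0 scale0r; suff -> : y i - z = 0 by rewrite scaler0.
  apply/rowP => j; rewrite [RHS]mxE; apply/eqP; rewrite -normr_le0 -normrN.
  apply: (@linear_le_quadratic _ (rho - `|y i - x0|) _ 0
    ((L ^+ 2 + n.+1%:R) / 2)) => //.
  - by rewrite subr_gt0 yx0.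
  - by rewrite divr_ge0// addr_ge0 ?sqr_ge0.
  - move=> t ht; pose h : 'rV[R]_n.+1 := t *: delta_mx 0 j.
    have nh : `|h| <= `|t| by exact: norm_scale_delta.
    have := dy i Pi (y i + h); rewrite addrC addKr => /(_ (le_trans nh ht)).
    rewrite d0 !mul0r add0r /h dotpZr dotp_delta -/h.
    have h2 : `|h| ^+ 2 <= t ^+ 2.
      by rewrite -[leRHS]real_normK ?num_real// ler_sqr ?nnegrE.
    have C0 : 0 <= (L ^+ 2 + n.+1%:R) / 2 by rewrite divr_ge0// addr_ge0 ?sqr_ge0.
    by have := ler_wpM2l C0 h2; lra.
have dropQ (V : nmodType) (F : 'I_k -> V) :
    (forall i, P i -> d i = 0 -> F i = 0) ->
    \sum_(i | P i && (0 < d i)) F i = \sum_(i | P i) F i.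
  move=> F0; rewrite [RHS](bigID (fun i => 0 < d i)) /= [X in _ = _ + X]big1 ?addr0//.
  move=> i /andP[Pi]; rewrite -leNgt => d0; apply: F0 => //.
  by apply/eqP; rewrite eq_le d0 overshoot_ge0.
exists (fun i => P i && (0 < d i)), (fun i => 2 * N * d i), y,
  (fun i => (d i)^-1 *: (y i - z)); split.
- by move=> i /andP[Pi di]; rewrite mulr_gt0.
- by rewrite dropQ// => i _ ->; rewrite mulr0.
- by move=> i /andP[/yx0].
- move=> i /andP[Pi d0].
  pose C := (L ^+ 2 + n.+1%:R) / 2.
  have C0 : 0 <= C by rewrite divr_ge0// addr_ge0 ?sqr_ge0.
  apply: (@superdiff_quadratic _ _ _ _ _ (rho - `|y i - x0|) ((d i)^-1 * C)).
  + by rewrite subr_gt0 yx0.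
  + by rewrite mulr_ge0// invr_ge0 ltW.
  + move=> w wy; rewrite -(ler_pM2l d0) !mulrDr; apply: le_trans (dy i Pi w wy) _.
    rewrite [dotp (_ *: _) _]dotpC dotpZr [dotp (w - _) _]dotpC.
    by rewrite !mulrA mulfV ?gt_eqF// !mul1r.
- rewrite dropQ => [|i _ ->]; last by rewrite mulr0 scale0r.
  rewrite (eq_bigr (fun i => 2 * N *: (y i - z))) => [|i Pi]; last exact: dq.
  rewrite distrC; apply: row_norm_le => [|j]; first by rewrite mulr_ge0// ltW.
  apply: (@linear_le_quadratic _ (rho / 2) _ _ (N * \sum_(i | P i) 1)).
  + by rewrite divr_gt0.
  + by rewrite mulr_ge0// ltW.
  + by rewrite mulr_ge0// ltW.
  + move=> t ht; apply: le_trans (dz t j ht).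
    rewrite !mxE summxE mulr_sumr.
    by rewrite [in leLHS](eq_bigr (fun i => 2 * N * (y i - z) 0 j)) //
      => i _; rewrite mxE.
Qed.

(** * Continuity, finite minima and Lipschitz functions *)

(** Uniformity in q comes from the compactness of the ball. *)
Lemma near_uniform_on_ball (R : realType) (n : nat) (F : 'rV[R]_n -> 'rV[R]_n -> R)
    (x : 'rV[R]_n) (L eta : R) :
  continuous (fun z : 'rV[R]_n * 'rV[R]_n => F z.1 z.2) -> 0 < L -> 0 < eta ->
  \forall y \near x, forall q, `|q| <= L -> F x q <= F y q + eta.
Proof.
move=> cF L0 eta0.
have cK : compact (closed_ball (0 : 'rV[R]_n) L).
  apply: bounded_closed_compact; last by apply: closed_ball_closed.
  exists L; split; first exact: num_real.
  move=> M LM q; rewrite closed_ballE// /closed_ball_ /= sub0r normrN => qL.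
  exact: le_trans qL (ltW LM).
suff nearK : \forall y \near x,
    closed_ball (0 : 'rV[R]_n) L `<=` (fun q => F x q <= F y q + eta).
  apply: filterS nearK => y yK q qL; apply: yK.
  by rewrite closed_ballE// /closed_ball_ /= sub0r normrN.
have /compact_near_coveringP ncK := cK.
apply: (ncK _ (nbhs x) (fun y q => F x q <= F y q + eta)) => q _.
have e20 : 0 < eta / 2 by rewrite divr_gt0.
have /cvgrPdist_le/(_ _ e20) H := cF (x, q).
have [[/= A B] [/= xA qB] AB] := H.
exists (B, A) => //= -[q' y] /= [Bq' Ay].
have h1 := AB (x, q') (conj (nbhs_singleton xA) Bq').
have h2 := AB (y, q') (conj Ay Bq').
by move: h1 h2; rewrite /= !ler_distl => /andP[h1 _] /andP[_ h2]; lra.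
Qed.

Lemma bigmin_fin_attained (R : realType) (I : finType) (f : I -> \bar R) :
  (0 < #|I|)%N -> (forall i, f i \is a fin_num) ->
  exists2 i, (\big[Order.min/+oo%E]_i f i = f i) &
    forall j, fine (f i) <= fine (f j).
Proof.
move=> /card_gt0P[i0 _] fn.
have [i _ fi] := @eq_bigmin _ _ _ +oo%E i0 predT f isT (fun i _ => leey _).
exists i => // j; rewrite -lee_fin !fineK//; rewrite -fi; exact: bigmin_le.
Qed.

Lemma continuous_pointwise_min (R : realType) (T : topologicalType) (k : nat)
    (u : 'I_k -> T -> R) (w : T -> R) (x : T) :
  (forall i, {for x, continuous (u i)}) ->
  (\forall y \near x, (exists i, w y = u i y) /\ forall i, w y <= u i y) ->
  {for x, continuous w}.
Proof.
move=> cu wmin; apply/cvgrPdist_le => e e0.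
have [[i wi] wle] := nbhs_singleton wmin.
have cnear : \forall y \near x, forall j, `|u j x - u j y| <= e.
  apply: filter_forall => j; have /cvgrPdist_le := cu j; exact.
apply: filterS2 wmin cnear => y [[j wj] wley] cy.
move: (cy i) (cy j) (wle j) (wley i); rewrite wi wj !ler_norml.
by move=> /andP[? ?] /andP[? ?] ? ?; apply/andP; split; lra.
Qed.

(** Functions strictly above the minimum at x stay above it near x. *)
Lemma near_active (R : realType) (T : topologicalType) (k : nat)
    (u : 'I_k -> T -> R) (w : T -> R) (x : T) :
  (forall i, {for x, continuous (u i)}) -> {for x, continuous w} ->
  (\forall y \near x, (exists i, w y = u i y) /\ forall i, w y <= u i y) ->
  \forall y \near x, exists2 i, u i x = w x & w y = u i y.
Proof.
move=> cu cw wmin.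
have [_ wle] := nbhs_singleton wmin.
have lts : \forall y \near x, forall j, u j x != w x -> w y < u j y.
  suff ltj j : \forall y \near x, u j x != w x -> w y < u j y.
    exact: filter_forall ltj.
  have [ujx|uj] := eqVneq (u j x) (w x); first by near=> y.
  have wj : 0 < u j x - w x by rewrite subr_gt0 lt_def uj wle.
  have cd : {for x, continuous (fun y => u j y - w y)}.
    by apply: cvgB; [exact: cu|exact: cw].
  by apply: filterS (cvgr_gt _ cd _ wj) => y; rewrite subr_gt0.
apply: filterS2 wmin lts => y [[i wi] _] lt.
by exists i => //; have [//|/lt] := eqVneq (u i x) (w x); rewrite wi ltxx.
Unshelve. all: by end_near.
Qed.

Lemma lipschitz_on_ball (R : realType) (n : nat) (u : 'rV[R]_n -> R)
    (x : 'rV[R]_n) (V : set 'rV[R]_n) :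
  nbhs x V -> [lipschitz u y | y in V] ->
  exists L rho : R, [/\ 0 < L, 0 < rho & forall y z,
    `|y - x| <= rho -> `|z - x| <= rho -> `|u y - u z| <= L * `|y - z|].
Proof.
move=> /nbhs_closed_ball[rho rho0 ballV] [M [_ lipM]].
exists (Num.max 1 (M + 1)), rho; split=> //; first by rewrite lt_max ltr01.
move=> y z yx zx; apply: (lipM _ _ (y, z)); last by split; exact: ballV.
by rewrite lt_max ltrDl ltr01 orbT.
Qed.

Lemma uniform_lipschitz_on_ball (R : realType) (n k : nat)
    (u : 'I_k -> 'rV[R]_n -> R) (P : pred 'I_k) (x : 'rV[R]_n) :
  (forall i, P i -> exists2 V : set 'rV[R]_n,
    nbhs x V & [lipschitz u i y | y in V]) ->
  exists L rho : R, [/\ 0 < L, 0 < rho & forall i, P i -> forall y z,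
    `|y - x| <= rho -> `|z - x| <= rho -> `|u i y - u i z| <= L * `|y - z|].
Proof.
move=> lip; have each i : exists Lr : R * R, [/\ 0 < Lr.1, 0 < Lr.2 &
    P i -> forall y z, `|y - x| <= Lr.2 -> `|z - x| <= Lr.2 ->
      `|u i y - u i z| <= Lr.1 * `|y - z|].
  have [Pi|nPi] := boolP (P i); last by exists (1, 1).
  have [V xV /(lipschitz_on_ball xV)[L [rho [L0 rho0 H]]]] := lip i Pi.
  by exists (L, rho).
have [f fP] := choice each.
exists (1 + \sum_i (f i).1), (\big[Num.min/1]_i (f i).2); split.
- by rewrite ltr_pwDl// sumr_ge0// => i _; have [/ltW] := fP i.
- by apply/bigmin_gtP; split=> // i _; have [] := fP i.
- move=> i Pi y z yx zx; have [L0 rho0 H] := fP i.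
  apply: (le_trans (H Pi y z _ _)).
  + by apply: le_trans yx _; exact: bigmin_le.
  + by apply: le_trans zx _; exact: bigmin_le.
  + rewrite ler_wpM2r// (bigD1 i)//= addrCA lerDl addr_ge0// sumr_ge0// => j _.
    by have [/ltW] := fP j.
Qed.

Lemma within_open_continuous (R : realType) (T : topologicalType) (A : set T)
    (f : T -> R) (x : T) :
  open A -> {within A, continuous f} -> A x -> {for x, continuous f}.
Proof.
move=> oA /subspace_continuousP cf Ax; have := cf x Ax.
by rewrite within_interior//; exact: open_nbhs_nbhs.
Qed.

(** * Values depend on two players only *)

Lemma ae_imply (R : realType) (P Q : R -> Prop) :
  (forall t, P t -> Q t) -> {ae (@lebesgue_measure R), forall t, P t} ->
  {ae (@lebesgue_measure R), forall t, Q t}.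
Proof.
exact: (@filterS _ _ (ae_filter_ringOfSetsType (@lebesgue_measure R)) P Q).
Qed.

(** Entry into the i-th target only involves evader i and the pursuer, so the
    starting points of the other evaders do not influence it. *)
Lemma entry_times_sub (R : realType) (m : nat) (G : game R m) (i : 'I_m)
    (a : ev_policy G) (b : pu_policy G) (x0 y0 : state R m) :
  well_posed G -> ev_policies a -> pu_policies b ->
  x0 0 (evader i) = y0 0 (evader i) -> x0 0 pursuer = y0 0 pursuer ->
  forall x, trajectory a b x0 x -> exists2 y, trajectory a b y0 y &
    entry_time (target_of G i) y = entry_time (target_of G i) x.
Proof.
move=> wp aA bB xyi xyp x [x00 xac xev xpu].
have [[y [y00 yac yev ypu]] _] := wp a b y0 aA bB.
(* Transplant the coordinates of evader i and of the pursuer from x into an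
   arbitrary trajectory y driven by the same controls: since the dynamics are
   decoupled, the result solves the state equation from y0. *)
pose own (k : 'I_m.+1) := (k == evader i) || (k == pursuer).
pose z t : state R m := \row_k (if own k then x t 0 k else y t 0 k).
have zx k : own k -> (fun t => z t 0 k) = (fun t => x t 0 k).
  by move=> ok; apply/funext => t; rewrite mxE ok.
have zy k : ~~ own k -> (fun t => z t 0 k) = (fun t => y t 0 k).
  by move=> /negbTE nk; apply/funext => t; rewrite mxE nk.
have owni : own (evader i) by rewrite /own eqxx.
have ownp : own pursuer by rewrite /own eqxx orbT.
exists z; first split.
- apply/rowP => k; rewrite mxE x00 y00; case: ifP => //.
  by case/orP => /eqP ->.
- by move=> T k T0; have [/zx|/zy] := boolP (own k) => ->; [exact: xac|exact: yac].
- move=> j; have [jo|jn] := boolP (own (evader j)).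
    have -> : (fun t => z t 0 (evader j)) = fun t => x t 0 (evader j) by exact: zx.
    suff -> : j = i.
      apply: ae_imply (xev i) => t h t0; rewrite [z t 0 _]mxE owni; exact: h.
    move: jo; rewrite /own => /orP[/eqP/lift_inj//|/eqP ji].
    by have := neq_lift ord_max j; rewrite /evader /pursuer in ji *; rewrite ji eqxx.
  have -> : (fun t => z t 0 (evader j)) = fun t => y t 0 (evader j) by exact: zy.
  by apply: ae_imply (yev j) => t h t0; rewrite [z t 0 _]mxE (negbTE jn); exact: h.
- have -> : (fun t => z t 0 pursuer) = fun t => x t 0 pursuer by exact: zx.
  by apply: ae_imply xpu => t h t0; rewrite [z t 0 _]mxE ownp; exact: h.
- congr (ereal_inf (_ @` _)); apply/seteqP.
  by split=> t /=; rewrite /target_of /= !mxE owni ownp.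
Qed.

(** The same nonanticipative maps are available from every initial state, so
    entry times can be compared map by map. *)
Lemma upper_value_own_coords (R : realType) (m : nat) (G : game R m) (i : 'I_m)
    (x0 y0 : state R m) :
  well_posed G ->
  x0 0 (evader i) = y0 0 (evader i) -> x0 0 pursuer = y0 0 pursuer ->
  upper_value G (target_of G i) x0 = upper_value G (target_of G i) y0.
Proof.
move=> wp xyi xyp.
suff H (x y : state R m) : x 0 (evader i) = y 0 (evader i) ->
    x 0 pursuer = y 0 pursuer ->
    (upper_value G (target_of G i) x <= upper_value G (target_of G i) y)%E.
  by apply/eqP; rewrite eq_le !H.
move=> {}xyi {}xyp; apply: ge_ereal_sup => _ [phi phina <-].
apply: le_ereal_sup_tmp; eexists; first by exists phi.
apply: le_ereal_inf_tmp => _ [[b z] [/= bB tz] <-].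
have phib : ev_policies (phi b) by apply: phina.1.
have [x' tx <-] := entry_times_sub wp phib bB (esym xyi) (esym xyp) tz.
by apply: ereal_inf_lbound; exists (b, x').
Qed.

(** The i-th value does not vary with the position of evader j. *)
Lemma superdiff_value_coord0 (R : realType) (m : nat) (G : game R m)
    (i j : 'I_m) (y q : state R m) :
  well_posed G -> j != i ->
  superdiff (fine \o upper_value G (target_of G i)) y q -> q 0 (evader j) = 0.
Proof.
move=> wp ji yq; apply/eqP; rewrite -normr_le0.
apply: (superdiff_coord_le ltr01 (lexx 0) yq) => t _.
rewrite mul0r subr_le0 /= le_eqVlt; apply/orP; left; apply/eqP; congr fine.
apply: upper_value_own_coords => //; rewrite !mxE /=.
  by rewrite /evader (inj_eq lift_inj) eq_sym (negbTE ji) mulr0 addr0.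
by rewrite /pursuer /evader (negbTE (neq_lift _ _)) mulr0 addr0.
Qed.

Lemma closed_target_of (R : realType) (m : nat) (G : game R m) (i : 'I_m) :
  closed (target_of G i).
Proof.
apply: (@preimage_closed _ _ (fun x : state R m => `|x 0 pursuer - x 0 (evader i)|)
  [set t | t <= cap_radius G]); last exact: closed_le.
move=> x _.
have ck k : (fun y : state R m => y 0 k : R) @ x --> (x 0 k : R).
  exact: coord_continuous.
exact: (@cvg_norm _ _ _ _ _ _ _
  (@cvgB _ _ _ _ (nbhs_filter x) _ _ _ _ (ck _) (ck _))).
Qed.

Lemma closed_target (R : realType) (m : nat) (G : game R m) : closed (target G).
Proof.
by apply: closed_bigcup => [|i _]; [exact: finite_finset|exact: closed_target_of].
Qed.

(** * Convexity of the Hamiltonian *)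

(** The Hamiltonians of all the players are, definitionally, of this form. *)
Definition support_fun (R : realType) (T : Type) (A : set T) (f : T -> R)
  (p : R) : \bar R := ereal_sup [set (p * f a)%:E | a in A].

Lemma support_fun_ub (R : realType) (T : Type) (A : set T) (f : T -> R) (p : R) a :
  support_fun A f p \is a fin_num -> A a -> p * f a <= fine (support_fun A f p).
Proof.
by move=> fn Aa; rewrite -lee_fin fineK//; apply: ereal_sup_ubound; exists a.
Qed.

Lemma support_fun_le (R : realType) (T : Type) (A : set T) (f : T -> R) (p M : R) :
  support_fun A f p \is a fin_num -> (forall a, A a -> p * f a <= M) ->
  fine (support_fun A f p) <= M.
Proof.
move=> fn fM; rewrite -lee_fin fineK//; apply: ge_ereal_sup => _ [a Aa <-].
by rewrite lee_fin fM.
Qed.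

Lemma support_fun0 (R : realType) (T : Type) (A : set T) (f : T -> R) :
  A !=set0 -> fine (support_fun A f 0) = 0.
Proof.
move=> [a0 Aa0]; suff -> : support_fun A f 0 = 0%E by [].
apply/eqP; rewrite eq_le; apply/andP; split.
  by apply: ge_ereal_sup => _ [a _ <-]; rewrite mul0r.
by apply: ereal_sup_ubound; exists a0; rewrite ?mul0r.
Qed.

Lemma support_fun_sum (R : realType) (T : Type) (A : set T) (f : T -> R)
    (I : finType) (P : pred I) (c p : I -> R) :
  (forall q, support_fun A f q \is a fin_num) -> (forall i, P i -> 0 <= c i) ->
  fine (support_fun A f (\sum_(i | P i) c i * p i)) <=
    \sum_(i | P i) c i * fine (support_fun A f (p i)).
Proof.
move=> fn c0; apply: support_fun_le => // a Aa; rewrite mulr_suml.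
apply: ler_sum => i Pi; rewrite -mulrA ler_wpM2l ?c0//.
exact: support_fun_ub.
Qed.

Lemma support_funZ (R : realType) (T : Type) (A : set T) (f : T -> R) (c p : R) :
  A !=set0 -> (forall q, support_fun A f q \is a fin_num) -> 0 <= c ->
  fine (support_fun A f (c * p)) = c * fine (support_fun A f p).
Proof.
move=> A0 fn c0; have [->|cn0] := eqVneq c 0; first by rewrite !mul0r support_fun0.
have cp : 0 < c by rewrite lt_def cn0.
have Z d q : 0 <= d ->
    fine (support_fun A f (d * q)) <= d * fine (support_fun A f q).
  move=> d0; apply: support_fun_le => // a Aa.
  by rewrite -mulrA ler_wpM2l// support_fun_ub.
apply/eqP; rewrite eq_le Z//= -ler_pdivlMl//.
by rewrite -{1}[p](mulKf cn0) Z// invr_ge0.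
Qed.

(** The pursuer's part is sublinear, which goes the right way. The evaders'
    parts are concave, which goes the wrong way in general; but here the i-th
    one sees c_i q_i and nothing else, so positive homogeneity makes it exactly
    additive. *)
Lemma hamiltonian_convex_comb (R : realType) (m : nat) (G : game R m)
    (x : state R m) (P : pred 'I_m) (c : 'I_m -> R) (q : 'I_m -> state R m) :
  (forall i : 'I_m, ev_ctrl G i !=set0) -> hamiltonians_real G ->
  (forall i, P i -> 0 <= c i) -> \sum_(i | P i) c i = 1 ->
  (forall i j, P i -> j != i -> q i 0 (evader j) = 0) ->
  hamiltonian G x (\sum_(i | P i) c i *: q i) <=
    \sum_(i | P i) c i * hamiltonian G x (q i).
Proof.
move=> A0 [evr pur] c0 c1 qown.
have evs j : \sum_(i | P i) (c i *: q i) 0 (evader j) =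
    if P j then c j * q j 0 (evader j) else 0.
  have [Pj|nPj] := boolP (P j).
    rewrite (bigD1 j)//= mxE big1 ?addr0// => i /andP[Pi ij].
    by rewrite mxE qown ?mulr0// eq_sym.
  rewrite big1// => i Pi; rewrite mxE qown ?mulr0//.
  by apply: contraNneq nPj => ->.
have evE i : P i -> \sum_(j < m) fine (ev_hamiltonian G j (x 0 (evader j))
    (q i 0 (evader j))) =
    fine (ev_hamiltonian G i (x 0 (evader i)) (q i 0 (evader i))).
  move=> Pi; rewrite (bigD1 i)//= big1 ?addr0// => j ji.
  by rewrite qown//; apply: support_fun0.
pose hp p := fine (pu_hamiltonian G (x 0 pursuer) p).
have -> : \sum_(i | P i) c i * hamiltonian G x (q i) =
    - (\sum_(i | P i) c i *
       fine (ev_hamiltonian G i (x 0 (evader i)) (q i 0 (evader i)))) +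
    \sum_(i | P i) c i * hp (- q i 0 pursuer) - 1.
  rewrite -[in RHS]c1 -!sumrN -!big_split /=; apply: eq_bigr => i Pi.
  by rewrite /hamiltonian evE// -/(hp _); ring.
rewrite /hamiltonian lerD2r; apply: lerD.
  rewrite lerN2 le_eqVlt; apply/orP; left; apply/eqP.
  rewrite [LHS]big_mkcond /=; apply: eq_bigr => j _; rewrite summxE evs.
  case: ifP => Pj; last by apply/esym; exact: support_fun0.
  by apply/esym/support_funZ; [exact: A0|exact: evr|exact: c0].
rewrite summxE -sumrN.
under eq_bigr do rewrite mxE -mulrN.
exact: (@support_fun_sum _ _ (pu_ctrl G) (pu_field G (x 0 pursuer)) _ P c
  (fun i => - q i 0 pursuer) (pur _) c0).
Qed.

(** * The minimum of the values *)

(** The subsolution inequality at a point where several values may coincide: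
    decompose p by the fuzzy rule, use the subsolution inequality of each value
    at a nearby point, and recombine by convexity. *)
Lemma hamiltonian_superdiff_min (R : realType) (m : nat) (G : game R m)
    (w : state R m -> R) (P : pred 'I_m) (x p : state R m) :
  let u i := fine \o upper_value G (target_of G i) in
  (forall i, ev_ctrl G i !=set0) -> well_posed G -> hamiltonians_real G ->
  continuous (fun z : state R m * state R m => hamiltonian G z.1 z.2) ->
  (forall i, P i -> \forall y \near x, forall q, superdiff (u i) y q ->
    hamiltonian G y q <= 0) ->
  (forall i, P i -> exists2 V : set (state R m), nbhs x V &
    [lipschitz u i y | y in V]) ->
  (forall i, P i -> u i x = w x) ->
  (\forall y \near x, exists2 i, P i & w y = u i y) ->
  superdiff w x p -> hamiltonian G x p <= 0.
Proof.
move=> u A0 wp Hr cF subsol lip ux active /superdiffP pw.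
have [L [r1 [L0 r10 lipL]]] := uniform_lipschitz_on_ball lip.
apply/ler_addgt0Pr => eta eta0; rewrite add0r.
have eta2 : 0 < eta / 2 by rewrite divr_gt0.
have cFx : \forall q \near p, hamiltonian G x p <= hamiltonian G x q + eta / 2.
  have /cvgrPdist_le/(_ _ eta2) [[/= A B] [/= xA pB] AB] := cF (x, p).
  apply: filterS pB => q Bq.
  have := AB (x, q) (conj (nbhs_singleton xA) Bq).
  by rewrite /= ler_distl => /andP[_].
have [r2 r20 cFr2] := nbhs_closed_ball cFx.
pose e := r2 / 2; have e0 : 0 < e by rewrite divr_gt0.
have subsol' : \forall y \near x, forall i, P i -> forall q,
    superdiff (u i) y q -> hamiltonian G y q <= 0.
  suff H i : \forall y \near x, P i -> forall q,
      superdiff (u i) y q -> hamiltonian G y q <= 0 by exact: filter_forall H.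
  have [Pi|nPi] := boolP (P i); last by near=> y.
  by apply: filterS (subsol i Pi) => y + _.
have [r3 r30 good] : exists2 rho : R, 0 < rho & forall y, `|y - x| <= rho ->
    [/\ exists2 i, P i & u i y <= w x + dotp p (y - x) + e * `|y - x|,
        forall i, P i -> forall q, superdiff (u i) y q -> hamiltonian G y q <= 0 &
        forall q, `|q| <= L -> hamiltonian G x q <= hamiltonian G y q + eta / 2].
  apply: nbhs_closed_ball; near=> y; split.
  - have wy : w y <= w x + dotp p (y - x) + e * `|y - x| by near: y; exact: pw.
    have [i Pi wui] : exists2 i, P i & w y = u i y by near: y.
    by exists i; rewrite // -wui.
  - by near: y.
  - by near: y; exact: near_uniform_on_ball.
pose rho := Num.min r1 r3.
have rho0 : 0 < rho by rewrite lt_min r10.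
have rho1 (t : R) : t <= rho -> t <= r1 by rewrite le_min => /andP[].
have rho3 (t : R) : t <= rho -> t <= r3 by rewrite le_min => /andP[].
have [|||Q [lam [y [q [QP lam1 yx yq pq]]]]] :=
  @fuzzy_min_rule R m m u P x p rho L (w x) e rho0 (ltW L0) e0.
- by move=> i Pi y z /rho1 yx /rho1 zx; exact: lipL.
- by move=> i Pi; rewrite ux.
- by move=> y /rho3/good[].
(* The Lipschitz bound keeps the q i in a fixed ball, on which moving the base
   point from y i to x changes the Hamiltonian by at most eta / 2. *)
have qL i : Q i -> `|q i| <= L.
  move=> Qi; have [Pi _] := QP i Qi; apply: row_norm_le => [|k]; first exact: ltW.
  apply: (@superdiff_coord_le _ _ (u i) (y i) _ k (rho - `|y i - x|)) => //.
  + by rewrite subr_gt0 yx.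
  + exact: ltW.
  + exact: yq.
  + move=> t tr; pose h : state R m := t *: delta_mx 0 k.
    have nh : `|h| <= `|t| by exact: norm_scale_delta.
    apply: (le_trans (ler_norm _)); rewrite -/h.
    have hx : `|y i + h - x| <= rho.
      by rewrite addrAC; apply: (le_trans (ler_normD _ _)); lra.
    apply: (le_trans (lipL i Pi _ _ (rho1 _ (ltW (yx i Qi))) (rho1 _ hx))).
    by rewrite opprD addNKr normrN ler_wpM2l// ltW.
have := cFr2 (\sum_(i | Q i) lam i *: q i).
rewrite distrC (le_trans pq) => [/(_ isT)|]; last by rewrite /e mulrCA divff ?mulr1.
have : hamiltonian G x (\sum_(i | Q i) lam i *: q i) <= eta / 2.
  apply: le_trans (hamiltonian_convex_comb _ _ _ _ _ _) _ => //.
  - by move=> i /QP[_ /ltW].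
  - by move=> i j Qi ji; apply: (superdiff_value_coord0 wp ji (yq i Qi)).
  - rewrite (_ : eta / 2 = \sum_(i | Q i) lam i * (eta / 2)); last first.
      by rewrite -mulr_suml lam1 mul1r.
    apply: ler_sum => i Qi.
    have [Pi lam0] := QP i Qi; rewrite ler_pM2l//.
    have [_ sub unif] := good _ (rho3 _ (ltW (yx i Qi))).
    have := sub i Pi _ (yq i Qi); have := unif _ (qL i Qi); lra.
lra.
Unshelve. all: by end_near.
Qed.

Theorem proposition3p1 (R : realType) (m : nat) (hm : (1 < m)%N)
  (G : game R m)
  (hr : 0 <= cap_radius G)
  (hA : forall i : 'I_m, ev_ctrl G i !=set0)
  (hB : pu_ctrl G !=set0)
  (hwp : well_posed G)
  (hH : hamiltonians_real G)
  (hF : continuous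
     (fun z : 'rV[R]_m.+1 * 'rV[R]_m.+1 => hamiltonian G z.1 z.2 : R))
  (ha : forall i : 'I_m,
     viscosity_solution (~` target_of G i) (hamiltonian G)
       (upper_value G (target_of G i)))
  (hb : forall i j : 'I_m, i != j -> forall x : 'rV[R]_m.+1,
     ~ target G x ->
     upper_value G (target_of G i) x = upper_value G (target_of G j) x ->
     exists2 V : set 'rV[R]_m.+1, nbhs x V &
       [lipschitz (fine (upper_value G (target_of G i) y) : R) | y in V] /\
       [lipschitz (fine (upper_value G (target_of G j) y) : R) | y in V]) :
  viscosity_solution (~` target G) (hamiltonian G)
    (fun x => \big[Order.min/+oo%E]_(i < m) upper_value G (target_of G i) x).
Proof.
pose u i := fine \o upper_value G (target_of G i).
set ubar := (fun x => \big[_/_]_(i < m) _); pose w := fine \o ubar.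
have outside i x : ~ target G x -> ~ target_of G i x by move=> + Tx; apply; exists i.
have fin i x : ~ target G x -> upper_value G (target_of G i) x \is a fin_num.
  by move=> /(outside i) nT; have [+ _ _ _] := ha i; apply.
have minP x : ~ target G x -> exists2 i, ubar x = upper_value G (target_of G i) x &
    forall j, u i x <= u j x.
  move=> nT; apply: bigmin_fin_attained => [|i]; last exact: fin.
  by rewrite card_ord ltnW.
have near_out x : ~ target G x -> \forall y \near x, ~ target G y.
  by move=> nT; apply: open_nbhs_nbhs; split=> //; exact/closed_openC/closed_target.
have wmin x : ~ target G x ->
    (exists i, w x = u i x) /\ forall i, w x <= u i x.
  by move=> /minP[i wi ui]; split; [exists i; rewrite /w /= wi|move=> j; rewrite /w /= wi].
have near_wmin x : ~ target G x ->
    \forall y \near x, (exists i, w y = u i y) /\ forall i, w y <= u i y.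
  by move=> /near_out; apply: filterS => y /wmin.
have cu i x : ~ target G x -> {for x, continuous (u i)}.
  move=> /(outside i) nT; have [_ cui _ _] := ha i.
  by apply: within_open_continuous cui _ => //; exact/closed_openC/closed_target_of.
have cw x : ~ target G x -> {for x, continuous w}.
  move=> nT; apply: (continuous_pointwise_min _ (near_wmin x nT)) => i; exact: cu.
split.
- by move=> x nT; have [i wi _] := minP x nT; rewrite wi fin.
- apply/subspace_continuousP => x nT; apply: cvg_within_filter; exact: cw.
- move=> x nT p; rewrite -/w => wp.
  have active := near_active (fun i => cu i x nT) (cw x nT) (near_wmin x nT).
  have [i0 wi0] := (wmin x nT).1.
  have subsol i : \forall y \near x, forall q, superdiff (u i) y q ->
      hamiltonian G y q <= 0.
    apply: filterS (near_out x nT) => y /(outside i) nTy.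
    by have [_ _ + _] := ha i; apply.
  have [[j [ji0 uj]]|single] := pselect (exists j, j != i0 /\ u j x = w x).
    pose P i := u i x == w x.
    apply: (@hamiltonian_superdiff_min _ _ _ w P) => //.
    + by move=> i _; exact: subsol.
    + move=> i /eqP ui; have [j' ij' uj'] : exists2 j', i != j' & u j' x = w x.
        have [->|ii0] := eqVneq i i0; first by exists j; rewrite 1?eq_sym.
        by exists i0.
      have eqv : upper_value G (target_of G i) x = upper_value G (target_of G j') x.
        by rewrite -[LHS]fineK ?fin// -[RHS]fineK ?fin//; congr (_%:E); rewrite [LHS]ui.
      by have [V xV [lipi _]] := hb i j' ij' x nT eqv; exists V.
    + by move=> i /eqP.
    + by apply: filterS active => y [i /eqP]; exists i.
  (* If only u i0 attains the minimum at x, then it is the minimum near x, and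
     no Lipschitz estimate is involved. *)
  suff : superdiff (u i0) x p by exact: nbhs_singleton (subsol i0) p.
  apply/superdiffP => e e0; have /superdiffP/(_ e e0) := wp.
  apply: filterS2 active => y [i ui wy]; rewrite wi0 wy.
  suff -> : i = i0 by [].
  by apply/eqP/negP => /negP ii0; apply: single; exists i.
- move=> x nT p; rewrite -/w => /subdiffP wp.
  have [i0 wi0] := (wmin x nT).1.
  have [_ _ _ super] := ha i0; apply: super; first exact: outside.
  apply/subdiffP => e e0; apply: filterS2 (wp e e0) (near_wmin x nT) => y.
  by rewrite wi0 => H [_ /(_ i0)]; apply: le_trans.
Qed.
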